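(* Let $b_1,b_2:\mathbb{R}\to\mathbb{R}$ be smooth functions for which there are constants $\underline\beta,\overline\beta$ such that, for $i=1,2$ and all $s\in\mathbb{R}$, $0<\underline\beta\le b_i'(s)\le\overline\beta<\infty$ and $b_i(-s)=-b_i(s)$. For $i=1,2$ let $\hat h_i:[0,\infty)\to[0,\infty)$ be the inverse of the strictly increasing function $[0,\infty)\to[0,\infty)$, $t\mapsto w_{*,i}(t)=\int_0^t b_i(s)\,ds$. Let $n\ge 1$ be a constant real exponent, and let $w_*:\mathbb{R}^2\to[0,\infty)$ be the function defined by $w_*(0,0)=0$ and, for $(h_1,h_2)\neq(0,0)$, by letting $w_*=w_*(h_1,h_2)>0$ be the unique positive solution of $$\left|\frac{h_1}{\hat h_1(w_* )}\right|^{n}+\left|\frac{h_2}{\hat h_2(w_* )}\right|^{n}=1.$$ Then $w_*$ is continuously differentiable. For exponent $n\ge 2$, the function $w_*$ is twice continuously differentiable on $\mathbb{R}^2\setminus\{(0,0)\}$.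
   Context: The setting is a planar model of an anisotropic magnetic material with coordinate axes aligned with the two principal (rolling and transverse) directions. Along these axes the magnetic flux $b$ and the magnetic field $h$ are assumed colinear, i.e. $b(h_1,0)=(b_1(h_1),0)$ and $b(0,h_2)=(0,b_2(h_2))$, so the scalar functions $b_i$ are the B--H curves in the principal directions, and $w_{*,i}$ are the corresponding coenergies along these axes. The function $w_*$ is the implicitly defined coenergy. Under these hypotheses the displayed equation has exactly one solution $w_*>0$ for every $(h_1,h_2)\neq(0,0)$, and setting $w_*(0,0)=0$ extends the resulting function continuously to $\mathbb{R}^2$, so $w_*$ is well defined.
   Formalization: Continuous differentiability of w_* is stated for n > 1 rather than n ≥ 1, since it fails at n = 1: for b_1 = b_2 = id, w_* = (|h_1|+|h_2|)^2/2 is not differentiable at (0,1). *)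

(* Defs.v *)
From Stdlib Require Import Reals.
From Coquelicot Require Import Coquelicot.
Open Scope R_scope.

Definition smooth (f : R -> R) : Prop :=
  forall (k : nat) (s : R), ex_derive_n f k s.

(* [b] is one of the two principal B-H curves; the total function [RInt] is
   used at continuous integrands only, where it is the Riemann integral. *)
Definition axis_coenergy (b : R -> R) (t : R) : R := RInt b 0 t.

(* Mutually inverse maps of the half-line [0, +oo); the values of [f] and [g]
   at negative arguments are irrelevant. *)
Definition inverse_on_halfline (f g : R -> R) : Prop :=
  (forall t, 0 <= t -> 0 <= g t /\ f (g t) = t) /\
  (forall t, 0 <= t -> 0 <= f t /\ g (f t) = t).

(* |x|^n for a real exponent n > 0. The case distinction is needed because
   [ln 0 = 0], whence [Rpower 0 n = 1]. *)
Definition abs_pow (x n : R) : R :=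
  if Req_dec_T x 0 then 0 else Rpower (Rabs x) n.

Definition coenergy_equation (hhat1 hhat2 : R -> R) (n h1 h2 w : R) : Prop :=
  abs_pow (h1 / hhat1 w) n + abs_pow (h2 / hhat2 w) n = 1.

Definition is_coenergy (hhat1 hhat2 : R -> R) (n : R) (w : R -> R -> R) : Prop :=
  w 0 0 = 0 /\
  forall h1 h2 : R, (h1, h2) <> (0, 0) ->
    unique (fun s => 0 < s /\ coenergy_equation hhat1 hhat2 n h1 h2 s) (w h1 h2).

(* Class C^k on a set [U], which has to be open: [differentiable_pt] is Frechet
   differentiability, and the partial derivatives of f must be of class
   C^(k-1) on [U]. *)
Fixpoint class_C (k : nat) (U : R -> R -> Prop) (f : R -> R -> R) : Prop :=
  match k with
  | O => forall x y, U x y -> continuity_2d_pt f x y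
  | S k' =>
      (forall x y, U x y -> differentiable_pt f x y) /\
      class_C k' U (fun x y => Derive (fun u => f u y) x) /\
      class_C k' U (fun x y => Derive (fun v => f x v) y)
  end.

Definition plane (x y : R) : Prop := True.

Definition punctured_plane (x y : R) : Prop := (x, y) <> (0, 0).

(* Main.v *)
Require Import Defs.
From Stdlib Require Import Reals Lra FunctionalExtensionality.
From Coquelicot Require Import Coquelicot.
Open Scope R_scope.

(** Put psi(x) = |x|^n and p_i(s) = hhat_i(s)^(-n). For s > 0 the equation that
    defines w reads

      psi(h1) p_1(s) + psi(h2) p_2(s) = 1,

    which separates the field from the unknown. Each p_i is C^1 on s > 0 with
    negative derivative, since hhat_i' = 1 / b_i(hhat_i) > 0, and psi(h1),
    psi(h2) do not both vanish away from the origin; so implicit differentiation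
    (implicit_slopes) applies on the punctured plane and gives

      dw/dh1 = - psi'(h1) p_1(w) / (psi(h1) p_1'(w) + psi(h2) p_2'(w)),

    and symmetrically for h2. The function psi' is n times the signed power
    sign(x) |x|^(n-1), which is continuous for n > 1 and C^1 for n >= 2, and the
    p_i' are C^1 on s > 0. Hence w is C^1 off the origin for n > 1. For n >= 2
    the right side is a combination of C^1 functions, w being one of them, so
    the partial derivatives are C^1 off the origin and w is C^2 there
    (partial_C1).

    At the origin only estimates are needed. Each hhat_i(s) lies between two
    fixed multiples of the square root of s, because b_i(t) lies between
    lo t and hi t. Together with the equation this gives
    hhat_i(w) <= (hi / lo) (|h1| + |h2|) (hhat_le_field), so w is at most a
    constant times the square of |h1| + |h2| and is differentiable at 0 with
    zero gradient. The gradient formula is bounded by a constant times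
    hhat_i(w) (partial_bound), hence tends to 0 at the origin.

    Differentiability is handled throughout in the form of Caratheodory: an
    increment is a slope, continuous at the point, times the increments of the
    variables. *)

(** * Differentiability through continuous slopes *)

(** Caratheodory's form of differentiability: sums, products and compositions
    become algebraic identities between increments, and an implicitly defined
    function can be differentiated by solving such an identity for its
    increment. *)
Definition slopes (f : R -> R -> R) (x y lx ly : R) : Prop :=
  exists A B : R -> R -> R,
    continuity_2d_pt A x y /\ continuity_2d_pt B x y /\
    A x y = lx /\ B x y = ly /\
    locally_2d (fun u v => f u v - f x y = A u v * (u - x) + B u v * (v - y)) x y.

Lemma slopes_differentiable f x y lx ly :
  slopes f x y lx ly -> differentiable_pt_lim f x y lx ly.
Proof.
  intros (A & B & cA & cB & <- & <- & HAB) eps.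
  specialize (cA (pos_div_2 eps)). specialize (cB (pos_div_2 eps)).
  generalize (locally_2d_and _ _ _ _ HAB (locally_2d_and _ _ _ _ cA cB)).
  apply locally_2d_impl, locally_2d_forall.
  intros u v (E & HA & HB). simpl in HA, HB. rewrite E.
  replace (A u v * (u - x) + B u v * (v - y) - (A x y * (u - x) + B x y * (v - y)))
    with ((A u v - A x y) * (u - x) + (B u v - B x y) * (v - y)) by ring.
  eapply Rle_trans; [apply Rabs_triang|]. rewrite !Rabs_mult.
  pose proof (Rmax_l (Rabs (u - x)) (Rabs (v - y))).
  pose proof (Rmax_r (Rabs (u - x)) (Rabs (v - y))).
  pose proof (Rabs_pos (u - x)). pose proof (Rabs_pos (v - y)).
  pose proof (Rabs_pos (A u v - A x y)). pose proof (Rabs_pos (B u v - B x y)).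
  set (m := Rmax _ _) in *.
  assert (Rabs (A u v - A x y) * Rabs (u - x) <= eps / 2 * m)
    by (apply Rmult_le_compat; lra).
  assert (Rabs (B u v - B x y) * Rabs (v - y) <= eps / 2 * m)
    by (apply Rmult_le_compat; lra).
  lra.
Qed.

Lemma slopes_continuous f x y lx ly :
  slopes f x y lx ly -> continuity_2d_pt f x y.
Proof.
  intros H. apply differentiable_continuity_pt. exists lx, ly.
  now apply slopes_differentiable.
Qed.

Lemma slopes_partials f x y lx ly :
  slopes f x y lx ly ->
  Derive (fun u => f u y) x = lx /\ Derive (fun v => f x v) y = ly.
Proof.
  intros H. now apply differentiable_pt_lim_unique, slopes_differentiable.
Qed.

Lemma slope_of_is_derive f x l :
  is_derive f x l ->
  exists q, continuity_pt q x /\ q x = l /\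
    forall y, f y - f x = q y * (y - x).
Proof.
  intros H.
  exists (fun y => if Req_dec_T y x then l else (f y - f x) / (y - x)).
  split; [|split].
  - apply is_derive_Reals in H. intros e He.
    destruct (H e He) as [d Hd]. exists d. split; [apply cond_pos|].
    intros y [[_ Hy] Hyd]. simpl in *. unfold R_dist, Rdist in *.
    destruct (Req_dec_T x x) as [_|n]; [|now elim n].
    destruct (Req_dec_T y x) as [E|_]; [now elim Hy|].
    specialize (Hd (y - x)). replace (x + (y - x)) with y in Hd by ring.
    apply Hd; lra.
  - now destruct (Req_dec_T x x).
  - intros y. destruct (Req_dec_T y x) as [->|n]; [ring|].
    field; lra.
Qed.

Lemma is_derive_continuity f x l : is_derive f x l -> continuity_pt f x.
Proof.
  intros H. apply continuity_pt_filterlim, (ex_derive_continuous f x). now exists l.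
Qed.

Lemma is_derive_of_slope f q x :
  continuity_pt q x ->
  locally x (fun y => f y - f x = q y * (y - x)) -> is_derive f x (q x).
Proof.
  intros Hq [d0 E]. apply is_derive_Reals. intros e He.
  destruct (Hq e He) as (d & Hd & H).
  exists (mkposreal _ (Rmin_pos d0 d (cond_pos d0) Hd)). simpl.
  intros h Hh Hhd. rewrite E.
  - replace (q (x + h) * (x + h - x) / h) with (q (x + h)) by (field; lra).
    apply H. split.
    + split; [exact I|]. lra.
    + simpl. unfold Rdist. replace (x + h - x) with h by ring.
      eapply Rlt_le_trans; [apply Hhd|apply Rmin_r].
  - change (Rabs (x + h - x) < d0). replace (x + h - x) with h by ring.
    eapply Rlt_le_trans; [apply Hhd|apply Rmin_l].
Qed.

Lemma slopes_fst x y : slopes (fun u _ => u) x y 1 0.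
Proof.
  exists (fun _ _ => 1), (fun _ _ => 0). repeat split; try apply continuity_2d_pt_const.
  apply locally_2d_forall; intros; ring.
Qed.

Lemma slopes_snd x y : slopes (fun _ v => v) x y 0 1.
Proof.
  exists (fun _ _ => 0), (fun _ _ => 1). repeat split; try apply continuity_2d_pt_const.
  apply locally_2d_forall; intros; ring.
Qed.

Lemma slopes_plus f g x y fx fy gx gy :
  slopes f x y fx fy -> slopes g x y gx gy ->
  slopes (fun u v => f u v + g u v) x y (fx + gx) (fy + gy).
Proof.
  intros (A & B & cA & cB & <- & <- & H) (A' & B' & cA' & cB' & <- & <- & H').
  exists (fun u v => A u v + A' u v), (fun u v => B u v + B' u v).
  repeat split; try now apply continuity_2d_pt_plus.
  generalize (locally_2d_and _ _ _ _ H H').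
  apply locally_2d_impl, locally_2d_forall; intros u v [E E'].
  replace (f u v + g u v - (f x y + g x y))
    with ((f u v - f x y) + (g u v - g x y)) by ring.
  rewrite E, E'; ring.
Qed.

Lemma slopes_mult f g x y fx fy gx gy :
  slopes f x y fx fy -> slopes g x y gx gy ->
  slopes (fun u v => f u v * g u v) x y
    (fx * g x y + f x y * gx) (fy * g x y + f x y * gy).
Proof.
  intros Hf Hg. pose proof (slopes_continuous _ _ _ _ _ Hg) as cg. revert Hf Hg.
  intros (A & B & cA & cB & <- & <- & H) (A' & B' & cA' & cB' & <- & <- & H').
  exists (fun u v => A u v * g u v + f x y * A' u v),
    (fun u v => B u v * g u v + f x y * B' u v).
  repeat split;
    try (apply continuity_2d_pt_plus; apply continuity_2d_pt_mult;
         auto using continuity_2d_pt_const).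
  generalize (locally_2d_and _ _ _ _ H H').
  apply locally_2d_impl, locally_2d_forall; intros u v [E E'].
  replace (f u v * g u v - f x y * g x y)
    with ((f u v - f x y) * g u v + f x y * (g u v - g x y)) by ring.
  rewrite E, E'; ring.
Qed.

Lemma slopes_comp phi f x y l fx fy :
  is_derive phi (f x y) l -> slopes f x y fx fy ->
  slopes (fun u v => phi (f u v)) x y (l * fx) (l * fy).
Proof.
  intros (q & cq & <- & Hq)%slope_of_is_derive Hf.
  pose proof (slopes_continuous _ _ _ _ _ Hf) as cf.
  destruct Hf as (A & B & cA & cB & <- & <- & H).
  exists (fun u v => q (f u v) * A u v), (fun u v => q (f u v) * B u v).
  repeat split;
    try (apply continuity_2d_pt_mult; trivial; now apply continuity_1d_2d_pt_comp).
  revert H. apply locally_2d_impl, locally_2d_forall; intros u v E.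
  rewrite Hq, E; ring.
Qed.

(** * Continuously differentiable functions *)

Definition C1_1d (V : R -> Prop) (phi : R -> R) : Prop :=
  exists dphi, forall t, V t -> is_derive phi t (dphi t) /\ continuity_pt dphi t.

(** The partial derivatives are functions given along with f, and not values of
    Derive on a neighbourhood, so the closure properties below hold on any set
    U, open or not. *)
Definition C1_2d (U : R -> R -> Prop) (f : R -> R -> R) : Prop :=
  exists fx fy, forall x y, U x y ->
    slopes f x y (fx x y) (fy x y) /\
    continuity_2d_pt fx x y /\ continuity_2d_pt fy x y.

Lemma C1_2d_fst U : C1_2d U (fun u _ => u).
Proof.
  exists (fun _ _ => 1), (fun _ _ => 0). intros x y _.
  split; [apply slopes_fst | split; apply continuity_2d_pt_const].
Qed.

Lemma C1_2d_snd U : C1_2d U (fun _ v => v).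
Proof.
  exists (fun _ _ => 0), (fun _ _ => 1). intros x y _.
  split; [apply slopes_snd | split; apply continuity_2d_pt_const].
Qed.

Lemma C1_2d_plus U f g :
  C1_2d U f -> C1_2d U g -> C1_2d U (fun u v => f u v + g u v).
Proof.
  intros (fx & fy & Hf) (gx & gy & Hg).
  exists (fun u v => fx u v + gx u v), (fun u v => fy u v + gy u v).
  intros x y HU. destruct (Hf x y HU) as (? & ? & ?), (Hg x y HU) as (? & ? & ?).
  split; [now apply slopes_plus | split; now apply continuity_2d_pt_plus].
Qed.

Lemma C1_2d_mult U f g :
  C1_2d U f -> C1_2d U g -> C1_2d U (fun u v => f u v * g u v).
Proof.
  intros (fx & fy & Hf) (gx & gy & Hg).
  exists (fun u v => fx u v * g u v + f u v * gx u v),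
    (fun u v => fy u v * g u v + f u v * gy u v).
  intros x y HU. destruct (Hf x y HU) as (? & ? & ?), (Hg x y HU) as (? & ? & ?).
  split; [now apply slopes_mult |].
  split; apply continuity_2d_pt_plus; apply continuity_2d_pt_mult;
    eauto using slopes_continuous.
Qed.

Lemma C1_2d_comp (V : R -> Prop) U phi f :
  C1_1d V phi -> (forall x y, U x y -> V (f x y)) -> C1_2d U f ->
  C1_2d U (fun u v => phi (f u v)).
Proof.
  intros (dphi & Hphi) HV (fx & fy & Hf).
  exists (fun u v => dphi (f u v) * fx u v), (fun u v => dphi (f u v) * fy u v).
  intros x y HU. destruct (Hf x y HU) as (Sf & ? & ?).
  destruct (Hphi _ (HV x y HU)) as (? & ?).
  split; [now apply slopes_comp |].
  split; apply continuity_2d_pt_mult; trivial;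
    apply continuity_1d_2d_pt_comp; eauto using slopes_continuous.
Qed.

Lemma C1_1d_continuity (V : R -> Prop) phi t : C1_1d V phi -> V t -> continuity_pt phi t.
Proof.
  intros (d & H) Ht. eapply is_derive_continuity, (H t Ht).
Qed.

Lemma C1_1d_const V c : C1_1d V (fun _ => c).
Proof.
  exists (fun _ => 0). intros t _. split; [apply (is_derive_const c t)|].
  apply continuity_pt_const; now intros ? ?.
Qed.

Lemma C1_1d_opp V : C1_1d V Ropp.
Proof.
  exists (fun _ => - 1). intros t _. split.
  - exact (is_derive_opp (fun s => s) t 1 (is_derive_id t)).
  - apply continuity_pt_const; now intros ? ?.
Qed.

Lemma C1_1d_mult V f g :
  C1_1d V f -> C1_1d V g -> C1_1d V (fun t => f t * g t).
Proof.
  intros Hf Hg. pose proof Hf as [df Hf']. pose proof Hg as [dg Hg'].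
  exists (fun t => df t * g t + f t * dg t). intros t Ht.
  destruct (Hf' t Ht), (Hg' t Ht). split.
  - apply (is_derive_mult f g); trivial. intros; apply Rmult_comm.
  - apply continuity_pt_plus; apply continuity_pt_mult; trivial;
      eapply C1_1d_continuity; eauto.
Qed.

Lemma C1_1d_comp (V V' : R -> Prop) f g :
  C1_1d V' f -> (forall t, V t -> V' (g t)) -> C1_1d V g -> C1_1d V (fun t => f (g t)).
Proof.
  intros [df Hf] HV [dg Hg]. exists (fun t => dg t * df (g t)). intros t Ht.
  destruct (Hf (g t) (HV t Ht)), (Hg t Ht). split.
  - now apply (is_derive_comp f g).
  - apply continuity_pt_mult; trivial. apply (continuity_pt_comp g df); trivial.
    now apply (is_derive_continuity g t (dg t)).
Qed.

Lemma C1_1d_inv : C1_1d (fun t => t <> 0) Rinv.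
Proof.
  exists (fun t => - / (t * t)). intros t Ht. split.
  - evar_last; [apply (is_derive_inv (fun s => s) t 1 (is_derive_id t) Ht)|].
    field; trivial.
  - apply continuity_pt_opp. apply (continuity_pt_inv (fun t => t * t)).
    + apply continuity_pt_mult; apply continuity_pt_id.
    + now apply Rmult_integral_contrapositive_currified.
Qed.

Lemma class_C1_of_C1_2d U f :
  (forall x y, U x y -> locally_2d U x y) -> C1_2d U f -> class_C 1 U f.
Proof.
  intros HU (fx & fy & Hf). split; [|split].
  - intros x y H. destruct (Hf x y H) as [S _].
    exists (fx x y), (fy x y). now apply slopes_differentiable.
  - intros x y H. apply (continuity_2d_pt_ext_loc fx); [|now apply Hf].
    generalize (HU x y H). apply locally_2d_impl, locally_2d_forall.
    intros u v Huv. symmetry.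
    now destruct (slopes_partials _ _ _ _ _ (proj1 (Hf u v Huv))).
  - intros x y H. apply (continuity_2d_pt_ext_loc fy); [|now apply Hf].
    generalize (HU x y H). apply locally_2d_impl, locally_2d_forall.
    intros u v Huv. symmetry.
    now destruct (slopes_partials _ _ _ _ _ (proj1 (Hf u v Huv))).
Qed.

(** * Powers of the absolute value *)

Definition signed_pow (x r : R) : R := sign x * abs_pow x r.

Lemma abs_pow_0 r : abs_pow 0 r = 0.
Proof. unfold abs_pow. now destruct (Req_dec_T 0 0). Qed.

Lemma abs_pow_neq0 x r : x <> 0 -> abs_pow x r = Rpower (Rabs x) r.
Proof. intros H. unfold abs_pow. now destruct (Req_dec_T x 0). Qed.

Lemma abs_pow_gt0 x r : x <> 0 -> 0 < abs_pow x r.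
Proof. intros H. rewrite abs_pow_neq0 by trivial. apply exp_pos. Qed.

Lemma abs_pow_ge0 x r : 0 <= abs_pow x r.
Proof.
  destruct (Req_dec_T x 0) as [->|H].
  - rewrite abs_pow_0; apply Rle_refl.
  - now apply Rlt_le, abs_pow_gt0.
Qed.

Lemma sign_mul_self x : sign x * x = Rabs x.
Proof.
  destruct (Rtotal_order x 0) as [H|[->|H]].
  - rewrite sign_eq_m1, Rabs_left by trivial; ring.
  - rewrite sign_0, Rabs_R0; ring.
  - rewrite sign_eq_1, Rabs_right by lra; ring.
Qed.

Lemma abs_pow_succ x r : abs_pow x (r + 1) = Rabs x * abs_pow x r.
Proof.
  destruct (Req_dec_T x 0) as [->|H]; [rewrite !abs_pow_0; ring|].
  rewrite !abs_pow_neq0, Rpower_plus, Rpower_1 by trivial || now apply Rabs_pos_lt.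
  ring.
Qed.

Lemma abs_pow_eq x r : abs_pow x r = signed_pow x (r - 1) * x.
Proof.
  unfold signed_pow. replace r with (r - 1 + 1) at 1 by ring.
  rewrite abs_pow_succ, <- sign_mul_self; ring.
Qed.

Lemma signed_pow_eq x r : signed_pow x r = abs_pow x (r - 1) * x.
Proof.
  unfold signed_pow. replace r with (r - 1 + 1) at 1 by ring.
  rewrite abs_pow_succ, <- sign_mul_self.
  destruct (Rtotal_order x 0) as [H|[->|H]].
  - rewrite sign_eq_m1 by trivial; ring.
  - ring.
  - rewrite sign_eq_1 by trivial; ring.
Qed.

Lemma signed_pow_1 x : signed_pow x 1 = x.
Proof.
  rewrite signed_pow_eq. replace (1 - 1) with 0 by ring.
  destruct (Req_dec_T x 0) as [->|H]; [ring|].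
  rewrite abs_pow_neq0, Rpower_O by trivial || now apply Rabs_pos_lt. ring.
Qed.

Lemma Rabs_signed_pow x r : Rabs (signed_pow x r) = abs_pow x r.
Proof.
  unfold signed_pow. rewrite Rabs_mult, (Rabs_pos_eq (abs_pow x r)) by apply abs_pow_ge0.
  destruct (Rtotal_order x 0) as [H|[->|H]].
  - rewrite sign_eq_m1, (Rabs_left (-1)) by lra; ring.
  - rewrite abs_pow_0; ring.
  - rewrite sign_eq_1, Rabs_R1 by trivial; ring.
Qed.

Lemma abs_pow_div x t r : 0 < t -> abs_pow (x / t) r = abs_pow x r * Rpower t (- r).
Proof.
  intros Ht. destruct (Req_dec_T x 0) as [->|H].
  - unfold Rdiv. rewrite Rmult_0_l, abs_pow_0; ring.
  - assert (x / t <> 0).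
    { apply Rmult_integral_contrapositive_currified; trivial.
      apply Rinv_neq_0_compat; lra. }
    rewrite !abs_pow_neq0 by trivial. unfold Rdiv.
    rewrite Rabs_mult, (Rabs_pos_eq (/ t)) by (left; now apply Rinv_0_lt_compat).
    rewrite <- Rpower_mult_distr
      by (now apply Rabs_pos_lt || now apply Rinv_0_lt_compat).
    f_equal. unfold Rpower. rewrite ln_Rinv by trivial. f_equal; ring.
Qed.

Lemma abs_pow_le_compat x t r : 0 <= r -> 0 < t -> Rabs x <= t -> abs_pow x r <= Rpower t r.
Proof.
  intros Hr Ht H. destruct (Req_dec_T x 0) as [->|Hx].
  - rewrite abs_pow_0. left; apply exp_pos.
  - rewrite abs_pow_neq0 by trivial. apply Rle_Rpower_l; trivial.
    split; trivial. now apply Rabs_pos_lt.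
Qed.

(** If |x|^r <= 1 then |x| <= 1, and raising to a power of at least 1 can then
    only decrease |x|. *)
Lemma abs_pow_le_Rabs x r : 1 <= r -> abs_pow x r <= 1 -> abs_pow x r <= Rabs x.
Proof.
  intros Hr H1. destruct (Rle_lt_dec (Rabs x) 1) as [H|H].
  - replace r with (r - 1 + 1) by ring. rewrite abs_pow_succ.
    rewrite <- (Rmult_1_r (Rabs x)) at 2. apply Rmult_le_compat_l; [apply Rabs_pos|].
    eapply Rle_trans; [apply (abs_pow_le_compat x 1); lra|].
    unfold Rpower. rewrite ln_1, Rmult_0_r, exp_0. lra.
  - lra.
Qed.

Lemma continuity_abs_pow_0 r : 0 < r -> continuity_pt (fun x => abs_pow x r) 0.
Proof.
  intros Hr e He. exists (Rpower e (/ r)). split; [apply exp_pos|].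
  intros x [[_ Hx] Hd]. simpl in *. unfold Rdist in *.
  rewrite abs_pow_0, Rminus_0_r, Rabs_pos_eq by apply abs_pow_ge0.
  rewrite Rminus_0_r in Hd. rewrite abs_pow_neq0 by auto.
  replace e with (Rpower (Rpower e (/ r)) r) at 1.
  - apply Rlt_Rpower_l; trivial. split; trivial. apply Rabs_pos_lt; auto.
  - rewrite Rpower_mult, Rinv_l, Rpower_1; lra.
Qed.

Lemma is_derive_abs_pow_neq0 x r :
  x <> 0 -> is_derive (fun y => abs_pow y r) x (r * signed_pow x (r - 1)).
Proof.
  intros Hx. apply (is_derive_ext_loc (fun y => Rpower (Rabs y) r)).
  - exists (mkposreal _ (Rabs_pos_lt x Hx)). intros y Hy. symmetry. apply abs_pow_neq0.
    intros ->. change (Rabs (0 - x) < Rabs x) in Hy.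
    rewrite Rminus_0_l, Rabs_Ropp in Hy. lra.
  - evar_last.
    + apply (is_derive_comp (fun z => Rpower z r) Rabs).
      * apply is_derive_Reals, derivable_pt_lim_power. now apply Rabs_pos_lt.
      * apply (is_derive_Rabs (fun z => z) x 1); trivial. exact (is_derive_id x).
    + unfold signed_pow. rewrite abs_pow_neq0 by trivial.
      change (sign x * 1 * (r * Rpower (Rabs x) (r - 1))
              = r * (sign x * Rpower (Rabs x) (r - 1))). ring.
Qed.

Lemma continuity_abs_pow x r : 0 < r -> continuity_pt (fun y => abs_pow y r) x.
Proof.
  intros Hr. destruct (Req_dec_T x 0) as [->|Hx]; [now apply continuity_abs_pow_0|].
  apply continuity_pt_filterlim, (ex_derive_continuous (fun y => abs_pow y r) x).
  eexists. now apply is_derive_abs_pow_neq0.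
Qed.

Lemma continuity_signed_pow x r : 0 < r -> continuity_pt (fun y => signed_pow y r) x.
Proof.
  intros Hr. destruct (Req_dec_T x 0) as [->|Hx].
  - intros e He. destruct (continuity_abs_pow_0 r Hr e He) as (d & Hd & H).
    exists d. split; trivial. intros y Hy. specialize (H y Hy). simpl in *.
    unfold Rdist in *. unfold signed_pow at 2.
    rewrite sign_0, Rmult_0_l, Rminus_0_r, Rabs_signed_pow.
    now rewrite abs_pow_0, Rminus_0_r, Rabs_pos_eq in H by apply abs_pow_ge0.
  - apply (continuity_pt_ext (fun y => abs_pow y (r - 1) * y)).
    + intros y. symmetry. apply signed_pow_eq.
    + apply continuity_pt_mult; [|apply continuity_pt_id].
      apply continuity_pt_filterlim, (ex_derive_continuous (fun y => abs_pow y (r - 1)) x).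
      eexists. now apply is_derive_abs_pow_neq0.
Qed.

(** At 0 the difference quotient of |x|^r is the signed power of exponent
    r - 1, which is continuous. *)
Lemma is_derive_abs_pow x r :
  1 < r -> is_derive (fun y => abs_pow y r) x (r * signed_pow x (r - 1)).
Proof.
  intros Hr. destruct (Req_dec_T x 0) as [->|Hx]; [|now apply is_derive_abs_pow_neq0].
  evar_last.
  - apply (is_derive_of_slope _ (fun y => signed_pow y (r - 1))).
    + apply continuity_signed_pow; lra.
    + apply filter_forall. intros y. rewrite abs_pow_0, !Rminus_0_r. apply abs_pow_eq.
  - unfold signed_pow. rewrite sign_0; ring.
Qed.

Lemma is_derive_signed_pow x r :
  1 < r -> is_derive (fun y => signed_pow y r) x (r * abs_pow x (r - 1)).
Proof.
  intros Hr. destruct (Req_dec_T x 0) as [->|Hx].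
  - evar_last.
    + apply (is_derive_of_slope _ (fun y => abs_pow y (r - 1))).
      * apply continuity_abs_pow; lra.
      * apply filter_forall. intros y. unfold signed_pow at 2. rewrite sign_0, Rmult_0_l, !Rminus_0_r.
        apply signed_pow_eq.
    + rewrite abs_pow_0; ring.
  - apply (is_derive_ext (fun y => abs_pow y (r - 1) * y)).
    { intros y. symmetry. apply signed_pow_eq. }
    evar_last.
    + apply (is_derive_mult (fun y => abs_pow y (r - 1)) (fun y => y)).
      * now apply is_derive_abs_pow_neq0.
      * exact (is_derive_id x).
      * intros; apply Rmult_comm.
    + change ((r - 1) * signed_pow x (r - 1 - 1) * x + abs_pow x (r - 1) * 1
              = r * abs_pow x (r - 1)).
      rewrite (abs_pow_eq x (r - 1)). ring.
Qed.

Lemma C1_1d_abs_pow r : 1 < r -> C1_1d (fun _ => True) (fun x => abs_pow x r).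
Proof.
  intros Hr. exists (fun x => r * signed_pow x (r - 1)). intros x _. split.
  - now apply is_derive_abs_pow.
  - apply continuity_pt_mult; [apply continuity_pt_const; now intros ? ?|].
    apply continuity_signed_pow; lra.
Qed.

(** Exponent 1 needs its own argument: the signed power is then the identity,
    whose derivative 1 differs at 0 from the value 0 of abs_pow 0 0. *)
Lemma C1_1d_signed_pow r : 1 <= r -> C1_1d (fun _ => True) (fun x => signed_pow x r).
Proof.
  intros [Hr | <-].
  - exists (fun x => r * abs_pow x (r - 1)). intros x _. split.
    + now apply is_derive_signed_pow.
    + apply continuity_pt_mult; [apply continuity_pt_const; now intros ? ?|].
      apply continuity_abs_pow; lra.
  - exists (fun _ => 1). intros x _. split.
    + apply (is_derive_ext (fun y => y)).
      * intros y. symmetry. apply signed_pow_1.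
      * exact (is_derive_id x).
    + apply continuity_pt_const; now intros ? ?.
Qed.

Lemma C1_1d_Rpower r : C1_1d (fun t => 0 < t) (fun t => Rpower t r).
Proof.
  exists (fun t => r * Rpower t (r - 1)). intros t Ht. split.
  - now apply is_derive_Reals, derivable_pt_lim_power.
  - apply continuity_pt_mult; [apply continuity_pt_const; now intros ? ?|].
    apply derivable_continuous_pt. exists ((r - 1) * Rpower t (r - 1 - 1)).
    now apply derivable_pt_lim_power.
Qed.

(** * Implicit differentiation *)

Lemma decreasing_of_derive p dp :
  (forall s, 0 < s -> is_derive p s (dp s) /\ dp s < 0) ->
  forall s t, 0 < s -> s < t -> p t < p s.
Proof.
  intros H s t Hs Hst.
  destruct (MVT_gen p s t dp) as (c & Hc & E).
  - rewrite Rmin_left, Rmax_right by lra. intros z Hz. apply H; lra.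
  - rewrite Rmin_left, Rmax_right by lra. intros z Hz.
    apply (is_derive_continuity p z (dp z)). apply H; lra.
  - rewrite Rmin_left, Rmax_right in Hc by lra.
    destruct (H c) as [_ Hd]; [lra|].
    assert (dp c * (t - s) < 0) by (apply Rmult_neg_pos; lra). lra.
Qed.

Lemma weighted_sum_lt a b p p' q q' :
  0 <= a -> 0 <= b -> 0 < a + b -> p < p' -> q < q' -> a * p + b * q < a * p' + b * q'.
Proof.
  intros Ha Hb Hab Hp Hq. destruct (Rle_lt_or_eq_dec 0 a Ha) as [Ha'|Ha'].
  - apply Rplus_lt_le_compat.
    + now apply Rmult_lt_compat_l.
    + apply Rmult_le_compat_l; lra.
  - assert (0 < b) by lra. apply Rplus_le_lt_compat.
    + apply Rmult_le_compat_l; lra.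
    + now apply Rmult_lt_compat_l.
Qed.

Lemma continuity_2d_pt_gt f x y a :
  continuity_2d_pt f x y -> a < f x y -> locally_2d (fun u v => a < f u v) x y.
Proof.
  intros Hf Ha. assert (Hp : 0 < f x y - a) by lra.
  generalize (Hf (mkposreal _ Hp)). apply locally_2d_impl, locally_2d_forall.
  simpl. intros u v H. apply Rabs_def2 in H. lra.
Qed.

Lemma continuity_2d_pt_lt f x y a :
  continuity_2d_pt f x y -> f x y < a -> locally_2d (fun u v => f u v < a) x y.
Proof.
  intros Hf Ha. assert (Hp : 0 < a - f x y) by lra.
  generalize (Hf (mkposreal _ Hp)). apply locally_2d_impl, locally_2d_forall.
  simpl. intros u v H. apply Rabs_def2 in H. lra.
Qed.

Lemma punctured_plane_cases x y : punctured_plane x y -> x <> 0 \/ y <> 0.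
Proof.
  intros H. destruct (Req_dec_T x 0) as [->|Hx]; [|now left].
  destruct (Req_dec_T y 0) as [->|Hy]; [now elim H|now right].
Qed.

Lemma punctured_plane_open x y :
  punctured_plane x y -> locally_2d punctured_plane x y.
Proof.
  intros [H|H]%punctured_plane_cases.
  - generalize (continuity_2d_pt_neq_0 _ x y (continuity_2d_pt_id1 x y) H).
    apply locally_2d_impl, locally_2d_forall. intros u v Hu E. congruence.
  - generalize (continuity_2d_pt_neq_0 _ x y (continuity_2d_pt_id2 x y) H).
    apply locally_2d_impl, locally_2d_forall. intros u v Hu E. congruence.
Qed.

(** The left side is strictly decreasing in the unknown, so the solution
    stays between two values as long as the left side exceeds 1 at the lower
    and is below 1 at the upper one, which is an open condition on (x, y). *)
Lemma implicit_continuous (psi p1 p2 : R -> R) (w : R -> R -> R) :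
  (forall x, continuity_pt psi x) ->
  (forall x, 0 <= psi x) -> (forall x, x <> 0 -> 0 < psi x) ->
  (forall s t, 0 < s -> s < t -> p1 t < p1 s) ->
  (forall s t, 0 < s -> s < t -> p2 t < p2 s) ->
  (forall x y, punctured_plane x y ->
    0 < w x y /\ psi x * p1 (w x y) + psi y * p2 (w x y) = 1) ->
  forall x y, punctured_plane x y -> continuity_2d_pt w x y.
Proof.
  intros cpsi psi0 psi1 dec1 dec2 Hw x y Hxy eps.
  assert (Hmono : forall u v s t, punctured_plane u v -> 0 < s -> s < t ->
            psi u * p1 t + psi v * p2 t < psi u * p1 s + psi v * p2 s).
  { intros u v s t Huv Hs Hst. apply weighted_sum_lt; auto.
    destruct (punctured_plane_cases _ _ Huv) as [H|H]; apply psi1 in H.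
    - specialize (psi0 v); lra.
    - specialize (psi0 u); lra. }
  assert (cE : forall s, continuity_2d_pt (fun u v => psi u * p1 s + psi v * p2 s) x y).
  { intros s. apply continuity_2d_pt_plus; apply continuity_2d_pt_mult;
      try apply continuity_2d_pt_const; apply continuity_1d_2d_pt_comp; trivial;
      [apply continuity_2d_pt_id1 | apply continuity_2d_pt_id2]. }
  destruct (Hw x y Hxy) as [Hw0 E0].
  set (s0 := w x y) in *. pose proof (cond_pos eps).
  (* s0 / 2 keeps the lower test value positive when eps >= s0 *)
  set (a := Rmax (s0 / 2) (s0 - eps)).
  assert (Ha : 0 < a < s0 /\ s0 - eps <= a).
  { pose proof (Rmax_l (s0 / 2) (s0 - eps)). pose proof (Rmax_r (s0 / 2) (s0 - eps)).
    assert (a < s0) by (apply Rmax_lub_lt; lra). unfold a in *. lra. }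
  assert (L : locally_2d (fun u v => 1 < psi u * p1 a + psi v * p2 a) x y).
  { apply (continuity_2d_pt_gt _ x y 1 (cE a)). rewrite <- E0. apply Hmono; trivial; lra. }
  assert (0 < s0 + eps) by lra.
  assert (M : locally_2d (fun u v => psi u * p1 (s0 + eps) + psi v * p2 (s0 + eps) < 1) x y).
  { apply (continuity_2d_pt_lt _ x y 1 (cE (s0 + eps))).
    rewrite <- E0. apply Hmono; trivial; lra. }
  generalize (locally_2d_and _ _ _ _ (punctured_plane_open x y Hxy)
                (locally_2d_and _ _ _ _ L M)).
  apply locally_2d_impl, locally_2d_forall. intros u v (Huv & HL & HM).
  destruct (Hw u v Huv) as [Hs E].
  assert (a < w u v).
  { destruct (Rlt_le_dec a (w u v)) as [|[H'|H']]; trivial.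
    - pose proof (Hmono u v _ _ Huv Hs H'). lra.
    - rewrite H' in E. lra. }
  assert (w u v < s0 + eps).
  { destruct (Rlt_le_dec (w u v) (s0 + eps)) as [|[H'|H']]; trivial.
    - pose proof (Hmono u v (s0 + eps) (w u v) Huv ltac:(lra) H'). lra.
    - rewrite <- H' in E. lra. }
  apply Rabs_def1; lra.
Qed.

(** Subtract the equations at (x, y) and at a nearby point and write every
    increment as a slope times an increment of its variable: the result is
    linear in the increment of w, with a coefficient that is negative at
    (x, y), so dividing by it yields continuous slopes of w. *)
Lemma implicit_slopes (psi dpsi p1 dp1 p2 dp2 : R -> R) (w : R -> R -> R) :
  (forall x, is_derive psi x (dpsi x)) ->
  (forall x, 0 <= psi x) -> (forall x, x <> 0 -> 0 < psi x) ->
  (forall s, 0 < s -> is_derive p1 s (dp1 s) /\ dp1 s < 0) ->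
  (forall s, 0 < s -> is_derive p2 s (dp2 s) /\ dp2 s < 0) ->
  (forall x y, punctured_plane x y ->
    0 < w x y /\ psi x * p1 (w x y) + psi y * p2 (w x y) = 1) ->
  forall x y, punctured_plane x y ->
  let D := psi x * dp1 (w x y) + psi y * dp2 (w x y) in
  D < 0 /\
  slopes w x y (- (dpsi x * p1 (w x y)) * / D) (- (dpsi y * p2 (w x y)) * / D).
Proof.
  intros dpsiE psi0 psi1 Hp1 Hp2 Hw x y Hxy D.
  destruct (Hw x y Hxy) as [Hs0 E0].
  assert (HD : D < 0).
  { replace 0 with (psi x * 0 + psi y * 0) by ring.
    apply weighted_sum_lt; auto.
    - destruct (punctured_plane_cases _ _ Hxy) as [H|H]; apply psi1 in H.
      + specialize (psi0 y); lra.
      + specialize (psi0 x); lra.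
    - now apply Hp1.
    - now apply Hp2. }
  split; trivial.
  assert (cw : continuity_2d_pt w x y).
  { apply (implicit_continuous psi p1 p2); trivial.
    - intros z. eapply is_derive_continuity, dpsiE.
    - now apply (decreasing_of_derive p1 dp1).
    - now apply (decreasing_of_derive p2 dp2). }
  destruct (slope_of_is_derive _ _ _ (dpsiE x)) as (m1 & cm1 & vm1 & Em1).
  destruct (slope_of_is_derive _ _ _ (dpsiE y)) as (m2 & cm2 & vm2 & Em2).
  destruct (Hp1 _ Hs0) as [d1 _]. destruct (Hp2 _ Hs0) as [d2 _].
  destruct (slope_of_is_derive _ _ _ d1) as (q1 & cq1 & vq1 & Eq1).
  destruct (slope_of_is_derive _ _ _ d2) as (q2 & cq2 & vq2 & Eq2).
  set (Q := fun u v => psi x * q1 (w u v) + psi y * q2 (w u v)).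
  assert (cQ : continuity_2d_pt Q x y).
  { apply continuity_2d_pt_plus; apply continuity_2d_pt_mult;
      auto using continuity_2d_pt_const, continuity_1d_2d_pt_comp. }
  assert (vQ : Q x y = D) by (unfold Q, D; now rewrite vq1, vq2).
  assert (nQ : Q x y <> 0) by lra.
  exists (fun u v => - (m1 u * p1 (w u v)) * / Q u v),
    (fun u v => - (m2 v * p2 (w u v)) * / Q u v).
  split; [|split; [|split; [|split]]].
  - apply continuity_2d_pt_mult; [|now apply continuity_2d_pt_inv].
    apply continuity_2d_pt_opp, continuity_2d_pt_mult.
    + apply continuity_1d_2d_pt_comp; trivial. apply continuity_2d_pt_id1.
    + apply continuity_1d_2d_pt_comp; trivial.
      now apply (is_derive_continuity p1 _ (dp1 (w x y))).
  - apply continuity_2d_pt_mult; [|now apply continuity_2d_pt_inv].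
    apply continuity_2d_pt_opp, continuity_2d_pt_mult.
    + apply continuity_1d_2d_pt_comp; trivial. apply continuity_2d_pt_id2.
    + apply continuity_1d_2d_pt_comp; trivial.
      now apply (is_derive_continuity p2 _ (dp2 (w x y))).
  - now rewrite vm1, vQ.
  - now rewrite vm2, vQ.
  - generalize (locally_2d_and _ _ _ _ (punctured_plane_open x y Hxy)
                  (continuity_2d_pt_neq_0 _ _ _ cQ nQ)).
    apply locally_2d_impl, locally_2d_forall. intros u v [Huv HQ].
    destruct (Hw u v Huv) as [_ E].
    assert (L : m1 u * (u - x) * p1 (w u v) + m2 v * (v - y) * p2 (w u v)
                + Q u v * (w u v - w x y) = 0).
    { unfold Q.
      replace ((psi x * q1 (w u v) + psi y * q2 (w u v)) * (w u v - w x y))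
        with (psi x * (q1 (w u v) * (w u v - w x y))
              + psi y * (q2 (w u v) * (w u v - w x y))) by ring.
      rewrite <- Em1, <- Em2, <- Eq1, <- Eq2.
      rewrite <- E0 in E. lra. }
    apply (Rmult_eq_reg_l (Q u v)); trivial.
    transitivity (- (m1 u * (u - x) * p1 (w u v) + m2 v * (v - y) * p2 (w u v))).
    + lra.
    + field; trivial.
Qed.

(** * Principal axes *)

Record principal_axis (b hhat : R -> R) (lo hi : R) : Prop := {
  axis_smooth : smooth b;
  axis_lo_pos : 0 < lo;
  axis_bound : forall s, lo <= Derive b s <= hi;
  axis_odd : forall s, b (- s) = - b s;
  axis_inverse : inverse_on_halfline (axis_coenergy b) hhat }.

Lemma increment_bounds f df a b l u :
  a <= b -> (forall s, a <= s <= b -> is_derive f s (df s) /\ l <= df s <= u) ->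
  l * (b - a) <= f b - f a <= u * (b - a).
Proof.
  intros Hab H. destruct (MVT_gen f a b df) as (c & Hc & E).
  - rewrite Rmin_left, Rmax_right by lra. intros z Hz. apply H; lra.
  - rewrite Rmin_left, Rmax_right by lra. intros z Hz.
    apply (is_derive_continuity f z (df z)). apply H; lra.
  - rewrite Rmin_left, Rmax_right in Hc by lra. rewrite E.
    destruct (H c Hc) as [_ ?]. split; apply Rmult_le_compat_r; lra.
Qed.

Lemma axis_is_derive b g lo hi s :
  principal_axis b g lo hi -> is_derive b s (Derive b s).
Proof. intros H. apply Derive_correct. exact (axis_smooth _ _ _ _ H 1%nat s). Qed.

Lemma axis_C1 b g lo hi : principal_axis b g lo hi -> C1_1d (fun _ => True) b.
Proof.
  intros H. exists (Derive b). intros s _. split; [eapply axis_is_derive; eauto|].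
  apply continuity_pt_filterlim, (ex_derive_continuous (Derive b) s).
  exact (axis_smooth _ _ _ _ H 2%nat s).
Qed.

Lemma axis_continuous b g lo hi s : principal_axis b g lo hi -> continuity_pt b s.
Proof. intros H. now apply (C1_1d_continuity (fun _ => True)); [apply (axis_C1 _ _ _ _ H)|]. Qed.

Lemma axis_linear_bounds b g lo hi t :
  principal_axis b g lo hi -> 0 <= t -> lo * t <= b t <= hi * t.
Proof.
  intros H Ht.
  assert (b 0 = 0).
  { pose proof (axis_odd _ _ _ _ H 0) as O. rewrite Ropp_0 in O. lra. }
  assert (K : lo * (t - 0) <= b t - b 0 <= hi * (t - 0)).
  { apply (increment_bounds b (Derive b)); trivial.
    intros s _. split; [eapply axis_is_derive; eauto|].
    now apply (axis_bound _ _ _ _ H). }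
  lra.
Qed.

Lemma axis_coenergy_derive b g lo hi t :
  principal_axis b g lo hi -> is_derive (axis_coenergy b) t (b t).
Proof.
  intros H. assert (cb : forall s, continuous b s).
  { intros s. apply continuity_pt_filterlim. eapply axis_continuous; eauto. }
  apply (is_derive_RInt b (axis_coenergy b) 0 t); [|apply cb].
  apply filter_forall. intros s. apply (RInt_correct b).
  apply ex_RInt_continuous. intros; apply cb.
Qed.

(** The derivative of the coenergy lies between those of lo t^2/2 and
    hi t^2/2. *)
Lemma axis_coenergy_increment b g lo hi s t :
  principal_axis b g lo hi -> 0 <= s <= t ->
  lo * (t * t - s * s) <= 2 * (axis_coenergy b t - axis_coenergy b s)
    <= hi * (t * t - s * s).
Proof.
  intros H Hst.
  assert (D : forall k z, is_derive (fun t => axis_coenergy b t - k * (t * t)) z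
            (b z - k * (2 * z))).
  { intros k z. apply (is_derive_minus (axis_coenergy b) (fun t => k * (t * t))).
    - eapply axis_coenergy_derive; eauto.
    - auto_derive; [trivial|ring]. }
  split.
  - destruct (MVT_gen (fun t => axis_coenergy b t - lo / 2 * (t * t)) s t
      (fun z => b z - lo / 2 * (2 * z))) as (c & Hc & E).
    + intros; apply D.
    + intros z _. eapply is_derive_continuity, D.
    + rewrite Rmin_left, Rmax_right in Hc by lra.
      destruct (axis_linear_bounds _ _ _ _ c H ltac:(lra)) as [B _].
      assert (0 <= (b c - lo / 2 * (2 * c)) * (t - s)) by (apply Rmult_le_pos; lra).
      lra.
  - destruct (MVT_gen (fun t => axis_coenergy b t - hi / 2 * (t * t)) s t
      (fun z => b z - hi / 2 * (2 * z))) as (c & Hc & E).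
    + intros; apply D.
    + intros z _. eapply is_derive_continuity, D.
    + rewrite Rmin_left, Rmax_right in Hc by lra.
      destruct (axis_linear_bounds _ _ _ _ c H ltac:(lra)) as [_ B].
      assert (0 <= (hi / 2 * (2 * c) - b c) * (t - s)) by (apply Rmult_le_pos; lra).
      lra.
Qed.

Lemma axis_coenergy_0 b : axis_coenergy b 0 = 0.
Proof. apply (RInt_point 0 b). Qed.

Lemma hhat_pos b g lo hi s : principal_axis b g lo hi -> 0 < s -> 0 < g s.
Proof.
  intros H Hs. destruct (proj1 (axis_inverse _ _ _ _ H) s) as [[G|G] E]; [lra|trivial|].
  rewrite <- G, axis_coenergy_0 in E. lra.
Qed.

Lemma hhat_square_bounds b g lo hi s :
  principal_axis b g lo hi -> 0 < s ->
  lo * (g s * g s) <= 2 * s <= hi * (g s * g s).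
Proof.
  intros H Hs. pose proof (hhat_pos _ _ _ _ _ H Hs).
  pose proof (axis_coenergy_increment b g lo hi 0 (g s) H ltac:(lra)) as K.
  destruct (proj1 (axis_inverse _ _ _ _ H) s) as [_ E]; [lra|].
  rewrite E, axis_coenergy_0 in K. lra.
Qed.

(** The increment of the coenergy is at least lo (t + t0) |t - t0| / 2, and
    t + t0 >= t0. *)
Lemma hhat_lipschitz b g lo hi s s0 :
  principal_axis b g lo hi -> 0 < s -> 0 < s0 ->
  lo * g s0 * Rabs (g s - g s0) <= 2 * Rabs (s - s0).
Proof.
  intros H Hs Hs0.
  pose proof (hhat_pos _ _ _ _ _ H Hs). pose proof (hhat_pos _ _ _ _ _ H Hs0).
  destruct (proj1 (axis_inverse _ _ _ _ H) s) as [_ E]; [lra|].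
  destruct (proj1 (axis_inverse _ _ _ _ H) s0) as [_ E0]; [lra|].
  pose proof (axis_lo_pos _ _ _ _ H) as Hlo.
  destruct (Rle_lt_dec (g s0) (g s)) as [L|L].
  - destruct (axis_coenergy_increment b g lo hi (g s0) (g s) H ltac:(lra)) as [K _].
    rewrite E, E0 in K. rewrite (Rabs_pos_eq (g s - g s0)) by lra.
    pose proof (Rle_abs (s - s0)).
    assert (0 <= lo * g s * (g s - g s0)) by (repeat apply Rmult_le_pos; lra). lra.
  - destruct (axis_coenergy_increment b g lo hi (g s) (g s0) H ltac:(lra)) as [K _].
    rewrite E, E0 in K. rewrite (Rabs_left (g s - g s0)) by lra.
    pose proof (Rle_abs (- (s - s0))). rewrite Rabs_Ropp in *.
    assert (0 <= lo * g s * (g s0 - g s)) by (repeat apply Rmult_le_pos; lra). lra.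
Qed.

Lemma hhat_continuous b g lo hi s :
  principal_axis b g lo hi -> 0 < s -> continuity_pt g s.
Proof.
  intros H Hs e He.
  pose proof (hhat_pos _ _ _ _ _ H Hs). pose proof (axis_lo_pos _ _ _ _ H) as Hlo.
  assert (Hk : 0 < lo * g s) by now apply Rmult_lt_0_compat.
  assert (0 < lo * g s * e) by now apply Rmult_lt_0_compat.
  exists (Rmin s (lo * g s * e / 2)). split; [apply Rmin_pos; lra|].
  intros t [_ Ht]. simpl in *. unfold Rdist in *.
  pose proof (Rmin_l s (lo * g s * e / 2)). pose proof (Rmin_r s (lo * g s * e / 2)).
  assert (0 < t).
  { assert (A : Rabs (t - s) < s) by lra. apply Rabs_def2 in A. lra. }
  apply (Rmult_lt_reg_l (lo * g s)); trivial.
  eapply Rle_lt_trans; [eapply hhat_lipschitz; eauto|]. lra.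
Qed.

(** The inverse of a slope of the coenergy is a slope of its inverse function,
    continuous because hhat is. *)
Lemma hhat_is_derive b g lo hi s :
  principal_axis b g lo hi -> 0 < s -> is_derive g s (/ b (g s)).
Proof.
  intros H Hs. pose proof (hhat_pos _ _ _ _ _ H Hs) as Hg.
  destruct (slope_of_is_derive _ _ _ (axis_coenergy_derive b g lo hi (g s) H))
    as (Q & cQ & vQ & EQ).
  assert (Q (g s) <> 0).
  { rewrite vQ. destruct (axis_linear_bounds _ _ _ _ _ H (Rlt_le _ _ Hg)) as [B _].
    pose proof (Rmult_lt_0_compat _ _ (axis_lo_pos _ _ _ _ H) Hg). lra. }
  rewrite <- vQ.
  apply (is_derive_of_slope g (fun t => / Q (g t))).
  - apply continuity_pt_inv; trivial. apply (continuity_pt_comp g Q); trivial.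
    eapply hhat_continuous; eauto.
  - exists (mkposreal _ Hs). intros t Ht. change (Rabs (t - s) < s) in Ht.
    apply Rabs_def2 in Ht. specialize (EQ (g t)).
    rewrite (proj2 (proj1 (axis_inverse _ _ _ _ H) t ltac:(lra))) in EQ.
    rewrite (proj2 (proj1 (axis_inverse _ _ _ _ H) s ltac:(lra))) in EQ.
    rewrite EQ. destruct (Req_dec_T (Q (g t)) 0) as [Z|Z].
    + (* a vanishing slope forces t = s, where the slope is b (g s) > 0 *)
      assert (t = s) by (rewrite Z in EQ; lra). subst t. now elim H0.
    + field; trivial.
Qed.

Lemma axis_b_hhat_pos b g lo hi s : principal_axis b g lo hi -> 0 < s -> 0 < b (g s).
Proof.
  intros H Hs. pose proof (hhat_pos _ _ _ _ _ H Hs) as Hg.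
  destruct (axis_linear_bounds _ _ _ _ _ H (Rlt_le _ _ Hg)) as [B _].
  pose proof (Rmult_lt_0_compat _ _ (axis_lo_pos _ _ _ _ H) Hg). lra.
Qed.

Lemma hhat_C1 b g lo hi : principal_axis b g lo hi -> C1_1d (fun s => 0 < s) g.
Proof.
  intros H. exists (fun s => / b (g s)). intros s Hs. split.
  - eapply hhat_is_derive; eauto.
  - apply (continuity_pt_inv (fun s => b (g s))).
    + apply (continuity_pt_comp g b); [eapply hhat_continuous | eapply axis_continuous]; eauto.
    + pose proof (axis_b_hhat_pos _ _ _ _ _ H Hs). lra.
Qed.

(** The derivative of hhat(s)^(-n). *)
Definition dscale (b g : R -> R) (n s : R) : R :=
  - n * Rpower (g s) (- n - 1) * / b (g s).

Lemma scale_is_derive b g lo hi n s :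
  principal_axis b g lo hi -> 0 < n -> 0 < s ->
  is_derive (fun t => Rpower (g t) (- n)) s (dscale b g n s) /\ dscale b g n s < 0.
Proof.
  intros H Hn Hs. pose proof (hhat_pos _ _ _ _ _ H Hs) as Hg. split.
  - evar_last.
    + apply (is_derive_comp (fun z => Rpower z (- n)) g).
      * now apply is_derive_Reals, derivable_pt_lim_power.
      * eapply hhat_is_derive; eauto.
    + unfold dscale. apply Rmult_comm.
  - unfold dscale. pose proof (Rinv_0_lt_compat _ (axis_b_hhat_pos _ _ _ _ _ H Hs)).
    assert (0 < Rpower (g s) (- n - 1)) by apply exp_pos.
    assert (0 < n * Rpower (g s) (- n - 1) * / b (g s))
      by (repeat apply Rmult_lt_0_compat; trivial). lra.
Qed.

Lemma dscale_C1 b g lo hi n :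
  principal_axis b g lo hi -> C1_1d (fun s => 0 < s) (dscale b g n).
Proof.
  intros H. unfold dscale. apply C1_1d_mult; [apply C1_1d_mult; [apply C1_1d_const|]|].
  - apply (C1_1d_comp _ _ (fun t => Rpower t (- n - 1)) g (C1_1d_Rpower _)).
    + intros t. now apply (hhat_pos b g lo hi).
    + now apply (hhat_C1 b g lo hi).
  - apply (C1_1d_comp _ _ Rinv (fun t => b (g t)) C1_1d_inv).
    + intros t Ht. pose proof (axis_b_hhat_pos _ _ _ _ _ H Ht). lra.
    + apply (C1_1d_comp _ (fun _ => True) b g); trivial.
      * now apply (axis_C1 b g lo hi).
      * now apply (hhat_C1 b g lo hi).
Qed.

Lemma scale_C1 b g lo hi n :
  principal_axis b g lo hi -> C1_1d (fun s => 0 < s) (fun s => Rpower (g s) (- n)).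
Proof.
  intros H. apply (C1_1d_comp _ _ (fun t => Rpower t (- n)) g (C1_1d_Rpower _)).
  - intros t. now apply (hhat_pos b g lo hi).
  - now apply (hhat_C1 b g lo hi).
Qed.

(** * The gradient of the coenergy *)

Definition scaled_equation (g1 g2 : R -> R) (n x y s : R) : Prop :=
  abs_pow x n * Rpower (g1 s) (- n) + abs_pow y n * Rpower (g2 s) (- n) = 1.

Definition denominator (b1 g1 b2 g2 : R -> R) (n x y s : R) : R :=
  abs_pow x n * dscale b1 g1 n s + abs_pow y n * dscale b2 g2 n s.

(** The partial derivative in the direction of the axis listed first, as a
    function of the field and of the value s of the coenergy there. At the
    origin the signed power makes it 0. *)
Definition partial (b1 g1 b2 g2 : R -> R) (n x y s : R) : R :=
  - (n * signed_pow x (n - 1) * Rpower (g1 s) (- n)) * / denominator b1 g1 b2 g2 n x y s.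

Lemma scaled_equation_sym g1 g2 n x y s :
  scaled_equation g1 g2 n x y s -> scaled_equation g2 g1 n y x s.
Proof. unfold scaled_equation. now rewrite Rplus_comm. Qed.

Lemma denominator_sym b1 g1 b2 g2 n x y s :
  denominator b1 g1 b2 g2 n x y s = denominator b2 g2 b1 g1 n y x s.
Proof. apply Rplus_comm. Qed.

Lemma denominator_neg b1 g1 b2 g2 lo hi n x y s :
  principal_axis b1 g1 lo hi -> principal_axis b2 g2 lo hi -> 0 < n ->
  punctured_plane x y -> 0 < s -> denominator b1 g1 b2 g2 n x y s < 0.
Proof.
  intros H1 H2 Hn Hxy Hs. unfold denominator.
  replace 0 with (abs_pow x n * 0 + abs_pow y n * 0) by ring.
  pose proof (abs_pow_ge0 x n). pose proof (abs_pow_ge0 y n).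
  apply weighted_sum_lt; trivial.
  - destruct (punctured_plane_cases _ _ Hxy) as [K|K]; apply (abs_pow_gt0 _ n) in K; lra.
  - eapply scale_is_derive; eauto.
  - eapply scale_is_derive; eauto.
Qed.

Lemma partial_continuous b1 g1 b2 g2 lo hi n (X Y W : R -> R -> R) x y :
  principal_axis b1 g1 lo hi -> principal_axis b2 g2 lo hi -> 1 < n ->
  continuity_2d_pt X x y -> continuity_2d_pt Y x y -> continuity_2d_pt W x y ->
  0 < W x y -> punctured_plane (X x y) (Y x y) ->
  continuity_2d_pt (fun u v => partial b1 g1 b2 g2 n (X u v) (Y u v) (W u v)) x y.
Proof.
  intros H1 H2 Hn cX cY cW Ws HXY. unfold partial.
  pose proof (denominator_neg _ _ _ _ _ _ n _ _ _ H1 H2 ltac:(lra) HXY Ws).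
  assert (c : forall phi, C1_1d (fun s => 0 < s) phi ->
             continuity_2d_pt (fun u v => phi (W u v)) x y).
  { intros phi K. apply continuity_1d_2d_pt_comp; trivial. eapply C1_1d_continuity; eauto. }
  apply continuity_2d_pt_mult.
  - apply continuity_2d_pt_opp, continuity_2d_pt_mult; [apply continuity_2d_pt_mult|].
    + apply continuity_2d_pt_const.
    + apply (continuity_1d_2d_pt_comp (fun z => signed_pow z (n - 1))); trivial.
      apply continuity_signed_pow; lra.
    + apply (c (fun s => Rpower (g1 s) (- n))). eapply scale_C1; eauto.
  - apply continuity_2d_pt_inv; [|lra].
    apply continuity_2d_pt_plus; apply continuity_2d_pt_mult.
    + apply (continuity_1d_2d_pt_comp (fun z => abs_pow z n)); trivial.
      apply continuity_abs_pow; lra.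
    + apply c. eapply dscale_C1; eauto.
    + apply (continuity_1d_2d_pt_comp (fun z => abs_pow z n)); trivial.
      apply continuity_abs_pow; lra.
    + apply c. eapply dscale_C1; eauto.
Qed.

(** Here n >= 2 is needed: the signed power of exponent n - 1 is of class C^1
    exactly when n - 1 >= 1. *)
Lemma partial_C1 b1 g1 b2 g2 lo hi n U (X Y W : R -> R -> R) :
  principal_axis b1 g1 lo hi -> principal_axis b2 g2 lo hi -> 2 <= n ->
  C1_2d U X -> C1_2d U Y -> C1_2d U W ->
  (forall x y, U x y -> 0 < W x y /\ punctured_plane (X x y) (Y x y)) ->
  C1_2d U (fun u v => partial b1 g1 b2 g2 n (X u v) (Y u v) (W u v)).
Proof.
  intros H1 H2 Hn CX CY CW HU. unfold partial.
  assert (c : forall phi, C1_1d (fun s => 0 < s) phi -> C1_2d U (fun u v => phi (W u v))).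
  { intros phi K. eapply C1_2d_comp; [apply K| |trivial]. apply HU. }
  assert (cp : forall Z, C1_2d U Z -> C1_2d U (fun u v => abs_pow (Z u v) n)).
  { intros Z K. apply (C1_2d_comp (fun _ => True) U (fun z => abs_pow z n)); trivial.
    apply C1_1d_abs_pow; lra. }
  apply C1_2d_mult.
  - apply (C1_2d_comp (fun _ => True) U Ropp); [apply C1_1d_opp|trivial|].
    apply C1_2d_mult.
    + apply (C1_2d_comp (fun _ => True) U (fun z => n * signed_pow z (n - 1))); trivial.
      apply C1_1d_mult; [apply C1_1d_const|]. apply C1_1d_signed_pow; lra.
    + apply (c (fun s => Rpower (g1 s) (- n))). eapply scale_C1; eauto.
  - apply (C1_2d_comp (fun t => t <> 0) U Rinv).
    + apply C1_1d_inv.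
    + intros x y Hxy. destruct (HU x y Hxy) as [Ws HXY].
      pose proof (denominator_neg _ _ _ _ _ _ n _ _ _ H1 H2 ltac:(lra) HXY Ws). lra.
    + apply C1_2d_plus; apply C1_2d_mult; auto; apply c; eapply dscale_C1; eauto.
Qed.

(** * Bounds near the origin *)

Lemma Rabs_le_of_term_le1 x t n : 0 < n -> 0 < t -> abs_pow x n * Rpower t (- n) <= 1 -> Rabs x <= t.
Proof.
  intros Hn Ht H. apply Rnot_lt_le. intros L.
  assert (x <> 0) by (intros ->; rewrite Rabs_R0 in L; lra).
  rewrite abs_pow_neq0 in H by trivial.
  assert (Rpower t n < Rpower (Rabs x) n) by (apply Rlt_Rpower_l; lra).
  assert (E : Rpower t n * Rpower t (- n) = 1).
  { rewrite <- Rpower_plus. replace (n + - n) with 0 by ring. now apply Rpower_O. }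
  assert (Rpower t n * Rpower t (- n) < Rpower (Rabs x) n * Rpower t (- n))
    by (apply Rmult_lt_compat_r; [apply exp_pos|trivial]).
  lra.
Qed.

Lemma hi_pos b g lo hi : principal_axis b g lo hi -> 0 < lo <= hi.
Proof.
  intros H. pose proof (axis_lo_pos _ _ _ _ H). pose proof (axis_bound _ _ _ _ H 0). lra.
Qed.

(** Both scaling factors are comparable to the square root of s. *)
Lemma hhat_comparable b1 g1 b2 g2 lo hi s :
  principal_axis b1 g1 lo hi -> principal_axis b2 g2 lo hi -> 0 < s ->
  lo * g1 s <= hi * g2 s.
Proof.
  intros H1 H2 Hs. pose proof (hi_pos _ _ _ _ H1).
  pose proof (hhat_pos _ _ _ _ _ H1 Hs). pose proof (hhat_pos _ _ _ _ _ H2 Hs).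
  destruct (hhat_square_bounds _ _ _ _ _ H1 Hs) as [L _].
  destruct (hhat_square_bounds _ _ _ _ _ H2 Hs) as [_ M].
  apply Rsqr_incr_0; unfold Rsqr; try (apply Rmult_le_pos; lra).
  apply Rle_trans with (lo * (hi * (g2 s * g2 s))).
  - replace (lo * g1 s * (lo * g1 s)) with (lo * (lo * (g1 s * g1 s))) by ring.
    apply Rmult_le_compat_l; lra.
  - replace (hi * g2 s * (hi * g2 s)) with (hi * (hi * (g2 s * g2 s))) by ring.
    apply Rmult_le_compat_r; [|lra].
    apply Rmult_le_pos; [lra|]. apply Rmult_le_pos; lra.
Qed.

(** Both terms of the equation are at most 1, hence bounded by |x|/t1 and
    |y|/t2, which therefore add up to at least 1. *)
Lemma hhat_le_field b1 g1 b2 g2 lo hi n x y s :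
  principal_axis b1 g1 lo hi -> principal_axis b2 g2 lo hi -> 1 <= n -> 0 < s ->
  scaled_equation g1 g2 n x y s -> g1 s <= hi / lo * (Rabs x + Rabs y).
Proof.
  intros H1 H2 Hn Hs E. unfold scaled_equation in E. pose proof (hi_pos _ _ _ _ H1).
  pose proof (hhat_pos _ _ _ _ _ H1 Hs) as P1. pose proof (hhat_pos _ _ _ _ _ H2 Hs) as P2.
  pose proof (hhat_comparable _ _ _ _ _ _ _ H1 H2 Hs).
  rewrite <- !abs_pow_div in E by trivial.
  pose proof (abs_pow_ge0 (x / g1 s) n). pose proof (abs_pow_ge0 (y / g2 s) n).
  pose proof (abs_pow_le_Rabs (x / g1 s) n Hn ltac:(lra)) as A.
  pose proof (abs_pow_le_Rabs (y / g2 s) n Hn ltac:(lra)) as B.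
  rewrite Rabs_div, (Rabs_pos_eq (g1 s)) in A by lra.
  rewrite Rabs_div, (Rabs_pos_eq (g2 s)) in B by lra.
  assert (C : 1 <= Rabs x / g1 s + Rabs y / g2 s) by lra.
  pose proof (Rabs_pos x). pose proof (Rabs_pos y).
  apply (Rmult_le_compat_l (lo * g1 s)) in C; [|apply Rmult_le_pos; lra].
  assert (lo * g1 s * (Rabs y / g2 s) <= hi * Rabs y).
  { replace (hi * Rabs y) with (hi * g2 s * (Rabs y / g2 s)) by (field; lra).
    apply Rmult_le_compat_r; trivial. apply Rdiv_le_0_compat; lra. }
  replace (lo * g1 s * (Rabs x / g1 s + Rabs y / g2 s))
    with (lo * Rabs x + lo * g1 s * (Rabs y / g2 s)) in C by (field; lra).
  assert (lo * Rabs x <= hi * Rabs x) by (apply Rmult_le_compat_r; lra).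
  apply (Rmult_le_reg_l lo); [lra|].
  replace (lo * (hi / lo * (Rabs x + Rabs y))) with (hi * (Rabs x + Rabs y)) by (field; lra).
  lra.
Qed.

(** With t = g1 s, the numerator is at most n / t because |x| <= t. The
    denominator is -n times the mean of 1 / (t1 b1(t1)) and 1 / (t2 b2(t2)) with
    the two terms of the equation as weights, and t_i b_i(t_i) <= hi t_i^2,
    which is at most (hi^2 / lo) t^2. *)
Lemma partial_bound b1 g1 b2 g2 lo hi n x y s :
  principal_axis b1 g1 lo hi -> principal_axis b2 g2 lo hi -> 1 <= n -> 0 < s ->
  scaled_equation g1 g2 n x y s ->
  Rabs (partial b1 g1 b2 g2 n x y s) <= hi * hi / lo * g1 s.
Proof.
  intros H1 H2 Hn Hs E. unfold scaled_equation in E. pose proof (hi_pos _ _ _ _ H1).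
  pose proof (hhat_pos _ _ _ _ _ H1 Hs) as P1.
  set (A := abs_pow x n * Rpower (g1 s) (- n)) in *.
  set (B := abs_pow y n * Rpower (g2 s) (- n)) in *.
  assert (HA : 0 <= A) by (apply Rmult_le_pos; [apply abs_pow_ge0 | left; apply exp_pos]).
  assert (HB : 0 <= B) by (apply Rmult_le_pos; [apply abs_pow_ge0 | left; apply exp_pos]).
  set (t := g1 s) in *. set (M := hi * hi / lo * (t * t)).
  assert (HM : 0 < M).
  { unfold M, Rdiv. repeat apply Rmult_lt_0_compat; trivial; try lra.
    apply Rinv_0_lt_compat; lra. }
  assert (term : forall b g z, principal_axis b g lo hi ->
     n * (abs_pow z n * Rpower (g s) (- n)) * / M <= - (abs_pow z n * dscale b g n s)).
  { intros b g z K. unfold dscale. pose proof (hhat_pos _ _ _ _ _ K Hs) as P.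
    pose proof (axis_b_hhat_pos _ _ _ _ _ K Hs) as Pb.
    assert (T : 0 < g s * b (g s)) by now apply Rmult_lt_0_compat.
    assert (Hle : g s * b (g s) <= M).
    { destruct (axis_linear_bounds _ _ _ _ (g s) K ltac:(lra)) as [_ L].
      destruct (hhat_square_bounds _ _ _ _ _ K Hs) as [L1 _].
      destruct (hhat_square_bounds _ _ _ _ _ H1 Hs) as [_ L2]. fold t in L2.
      apply Rle_trans with (hi * (g s * g s)).
      - replace (hi * (g s * g s)) with (g s * (hi * g s)) by ring.
        apply Rmult_le_compat_l; lra.
      - unfold M. replace (hi * hi / lo * (t * t)) with (hi * (hi * (t * t) / lo)) by (field; lra).
        apply Rmult_le_compat_l; [lra|]. apply (proj1 (Rle_div_r _ _ lo ltac:(lra))).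
        rewrite Rmult_comm. lra. }
    replace (- n - 1) with (- n + - (1)) by ring.
    rewrite Rpower_plus, (Rpower_Ropp _ 1), Rpower_1 by trivial.
    replace (- (abs_pow z n * (- n * (Rpower (g s) (- n) * / g s) * / b (g s))))
      with (n * (abs_pow z n * Rpower (g s) (- n)) * / (g s * b (g s))) by (field; lra).
    apply Rmult_le_compat_l.
    - apply Rmult_le_pos; [lra|]. apply Rmult_le_pos; [apply abs_pow_ge0|left; apply exp_pos].
    - now apply Rinv_le_contravar. }
  pose proof (term b1 g1 x H1) as T1. pose proof (term b2 g2 y H2) as T2.
  fold t in T1. fold A in T1. fold B in T2.
  set (D := denominator b1 g1 b2 g2 n x y s).
  assert (HD : n * / M <= - D).
  { unfold D, denominator. replace (n * / M) with (n * (A + B) * / M) by (rewrite E; ring).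
    lra. }
  assert (Hx : Rabs x <= t) by (apply (Rabs_le_of_term_le1 x t n); unfold A in *; lra).
  assert (HN : abs_pow x (n - 1) * Rpower t (- n) <= / t).
  { apply Rle_trans with (Rpower t (n - 1) * Rpower t (- n)).
    - apply Rmult_le_compat_r; [left; apply exp_pos|]. apply abs_pow_le_compat; lra.
    - rewrite <- Rpower_plus. replace (n - 1 + - n) with (- (1)) by ring.
      rewrite Rpower_Ropp, Rpower_1 by trivial. lra. }
  assert (HnM : 0 < n * / M) by (apply Rmult_lt_0_compat; [lra|now apply Rinv_0_lt_compat]).
  unfold partial. fold D t.
  rewrite Rabs_mult, Rabs_Ropp, !Rabs_mult, Rabs_signed_pow, (Rabs_pos_eq n) by lra.
  rewrite (Rabs_pos_eq (Rpower _ _)) by (left; apply exp_pos).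
  rewrite Rabs_inv, (Rabs_left D) by lra.
  apply Rle_trans with (n * / t * / (n * / M)).
  - apply Rmult_le_compat.
    + repeat apply Rmult_le_pos; [lra|apply abs_pow_ge0|left; apply exp_pos].
    + left; apply Rinv_0_lt_compat; lra.
    + rewrite Rmult_assoc. apply Rmult_le_compat_l; lra.
    + now apply Rinv_le_contravar.
  - right. unfold M. field. lra.
Qed.

Lemma continuity_2d_pt_origin f C :
  0 <= C -> (forall u v, Rabs (f u v) <= C * (Rabs u + Rabs v)) ->
  continuity_2d_pt f 0 0.
Proof.
  intros HC H eps. pose proof (cond_pos eps).
  assert (Hd : 0 < eps / (2 * C + 1)) by (apply Rdiv_lt_0_compat; lra).
  exists (mkposreal _ Hd). simpl. intros u v Hu Hv. rewrite !Rminus_0_r in *.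
  assert (Z : f 0 0 = 0).
  { specialize (H 0 0). rewrite Rabs_R0, Rplus_0_r, Rmult_0_r in H.
    destruct (Req_dec_T (f 0 0) 0) as [|N]; trivial. apply Rabs_pos_lt in N. lra. }
  rewrite Z, Rminus_0_r. eapply Rle_lt_trans; [apply H|].
  set (d := eps / (2 * C + 1)) in *.
  assert (d * (2 * C + 1) = eps) by (unfold d; field; lra).
  assert (C * (Rabs u + Rabs v) <= C * (2 * d)) by (apply Rmult_le_compat_l; lra).
  lra.
Qed.

Lemma Rabs_sign_le1 u : Rabs (sign u) <= 1.
Proof.
  destruct (Rtotal_order u 0) as [H|[->|H]].
  - rewrite sign_eq_m1, Rabs_left by lra; lra.
  - rewrite sign_0, Rabs_R0; lra.
  - rewrite sign_eq_1, Rabs_R1 by trivial; lra.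
Qed.

(** The slopes f sign(u) / (|u| + |v|) and f sign(v) / (|u| + |v|) work because
    sign(u) u + sign(v) v = |u| + |v|. *)
Lemma slopes_quadratic f C :
  0 <= C -> (forall u v, Rabs (f u v) <= C * (Rabs u + Rabs v) ^ 2) ->
  slopes f 0 0 0 0.
Proof.
  intros HC H.
  assert (Z : f 0 0 = 0).
  { specialize (H 0 0). rewrite Rabs_R0 in H. replace (C * (0 + 0) ^ 2) with 0 in H by ring.
    destruct (Req_dec_T (f 0 0) 0) as [|N]; trivial. apply Rabs_pos_lt in N. lra. }
  assert (B : forall u v z, Rabs (f u v / (Rabs u + Rabs v) * sign z) <= C * (Rabs u + Rabs v)).
  { intros u v z. pose proof (Rabs_pos u). pose proof (Rabs_pos v).
    assert (Rabs (f u v / (Rabs u + Rabs v)) <= C * (Rabs u + Rabs v)).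
    { destruct (Req_dec_T (Rabs u + Rabs v) 0) as [E|N].
      - specialize (H u v). rewrite E in *. replace (C * 0 ^ 2) with 0 in H by ring.
        unfold Rdiv. rewrite Rabs_mult. pose proof (Rabs_pos (f u v)).
        replace (Rabs (f u v)) with 0 by lra. lra.
      - rewrite Rabs_div, (Rabs_pos_eq (Rabs u + Rabs v)) by lra.
        apply Rle_div_l; [lra|]. specialize (H u v). lra. }
    rewrite Rabs_mult, <- (Rmult_1_r (C * (Rabs u + Rabs v))).
    apply Rmult_le_compat; try apply Rabs_pos; trivial. apply Rabs_sign_le1. }
  exists (fun u v => f u v / (Rabs u + Rabs v) * sign u),
    (fun u v => f u v / (Rabs u + Rabs v) * sign v).
  split; [|split; [|split; [|split]]].
  - now apply (continuity_2d_pt_origin _ C).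
  - now apply (continuity_2d_pt_origin _ C).
  - rewrite sign_0; ring.
  - rewrite sign_0; ring.
  - apply locally_2d_forall. intros u v. rewrite Z, !Rminus_0_r.
    destruct (Req_dec_T (Rabs u + Rabs v) 0) as [E|N].
    + specialize (H u v). rewrite E in *. replace (C * 0 ^ 2) with 0 in H by ring.
      destruct (Req_dec_T (f u v) 0) as [F|F].
      * rewrite F; unfold Rdiv; ring.
      * apply Rabs_pos_lt in F. lra.
    + rewrite !Rmult_assoc, !sign_mul_self. field; trivial.
Qed.

(** * The coenergy *)

Section Coenergy.

Context (b1 g1 b2 g2 : R -> R) (lo hi n : R) (w : R -> R -> R).
Context (H1 : principal_axis b1 g1 lo hi) (H2 : principal_axis b2 g2 lo hi).
Context (Hn : 1 < n) (Hw : is_coenergy g1 g2 n w).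

Let wx x y := partial b1 g1 b2 g2 n x y (w x y).
Let wy x y := partial b2 g2 b1 g1 n y x (w x y).

Lemma coenergy_solves x y :
  punctured_plane x y -> 0 < w x y /\ scaled_equation g1 g2 n x y (w x y).
Proof.
  intros Hxy. destruct (proj2 Hw x y Hxy) as [[Hs E] _]. split; trivial.
  unfold scaled_equation. rewrite <- !abs_pow_div; trivial.
  - eapply hhat_pos; eauto.
  - eapply hhat_pos; eauto.
Qed.

Lemma field_cases x y : (x = 0 /\ y = 0) \/ punctured_plane x y.
Proof.
  destruct (Req_dec_T x 0) as [->|Hx]; [destruct (Req_dec_T y 0) as [->|Hy]|].
  - now left.
  - right. intros E. congruence.
  - right. intros E. congruence.
Qed.

Lemma coenergy_gradient_bound :
  exists C, 0 <= C /\ forall x y,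
    Rabs (wx x y) <= C * (Rabs x + Rabs y) /\ Rabs (wy x y) <= C * (Rabs x + Rabs y).
Proof.
  pose proof (hi_pos _ _ _ _ H1).
  assert (0 < hi / lo) by (apply Rdiv_lt_0_compat; lra).
  assert (K : 0 < hi * hi / lo) by (unfold Rdiv; rewrite Rmult_assoc; apply Rmult_lt_0_compat; trivial; lra).
  exists (hi * hi / lo * (hi / lo)). split.
  - apply Rmult_le_pos; lra.
  - intros x y. unfold wx, wy. destruct (field_cases x y) as [[-> ->]|Hxy].
    + unfold partial, signed_pow. rewrite sign_0.
      split; right;
        match goal with |- Rabs ?e = _ => replace e with 0 by ring end;
        rewrite Rabs_R0; ring.
    + destruct (coenergy_solves x y Hxy) as [Hs E].
      rewrite Rmult_assoc. split.
      * eapply Rle_trans.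
        { eapply partial_bound; [exact H1 | exact H2 | lra | exact Hs | exact E]. }
        apply Rmult_le_compat_l; [lra|].
        eapply hhat_le_field; [exact H1 | exact H2 | | exact Hs | exact E]; lra.
      * apply scaled_equation_sym in E.
        eapply Rle_trans.
        { eapply partial_bound; [exact H2 | exact H1 | lra | exact Hs | exact E]. }
        apply Rmult_le_compat_l; [lra|]. rewrite (Rplus_comm (Rabs x)).
        eapply hhat_le_field; [exact H2 | exact H1 | | exact Hs | exact E]; lra.
Qed.

Lemma coenergy_quadratic_bound :
  exists C, 0 <= C /\ forall x y, Rabs (w x y) <= C * (Rabs x + Rabs y) ^ 2.
Proof.
  pose proof (hi_pos _ _ _ _ H1).
  assert (K : 0 < hi / lo) by (apply Rdiv_lt_0_compat; lra).
  exists (hi * (hi / lo * (hi / lo)) / 2). split.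
  - apply Rmult_le_pos; [|lra]. apply Rmult_le_pos; [lra|]. apply Rmult_le_pos; lra.
  - intros x y. destruct (field_cases x y) as [[-> ->]|Hxy].
    + rewrite (proj1 Hw), Rabs_R0. right. ring.
    + destruct (coenergy_solves x y Hxy) as [Hs E]. rewrite Rabs_pos_eq by lra.
      destruct (hhat_square_bounds _ _ _ _ _ H1 Hs) as [_ L].
      pose proof (hhat_pos _ _ _ _ _ H1 Hs).
      pose proof (hhat_le_field _ _ _ _ _ _ n x y _ H1 H2 ltac:(lra) Hs E) as G.
      set (r := Rabs x + Rabs y) in *.
      assert (g1 (w x y) * g1 (w x y) <= hi / lo * r * (hi / lo * r))
        by (apply Rmult_le_compat; lra).
      assert (hi * (g1 (w x y) * g1 (w x y)) <= hi * (hi / lo * r * (hi / lo * r)))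
        by (apply Rmult_le_compat_l; lra).
      replace (hi * (hi / lo * (hi / lo)) / 2 * r ^ 2)
        with (hi * (hi / lo * r * (hi / lo * r)) / 2) by (field; lra). lra.
Qed.

Lemma coenergy_slopes x y : slopes w x y (wx x y) (wy x y).
Proof.
  destruct (field_cases x y) as [[-> ->]|Hxy].
  - replace (wx 0 0) with 0 by (unfold wx, partial, signed_pow; rewrite sign_0; ring).
    replace (wy 0 0) with 0 by (unfold wy, partial, signed_pow; rewrite sign_0; ring).
    destruct coenergy_quadratic_bound as (C & HC & HB). now apply (slopes_quadratic w C).
  - unfold wy, partial. rewrite denominator_sym.
    apply (implicit_slopes (fun z => abs_pow z n) (fun z => n * signed_pow z (n - 1))
             (fun s => Rpower (g1 s) (- n)) (dscale b1 g1 n)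
             (fun s => Rpower (g2 s) (- n)) (dscale b2 g2 n)); trivial.
    + intros z. now apply is_derive_abs_pow.
    + intros z. apply abs_pow_ge0.
    + intros z. apply abs_pow_gt0.
    + intros s Hs. eapply scale_is_derive; eauto; lra.
    + intros s Hs. eapply scale_is_derive; eauto; lra.
    + apply coenergy_solves.
Qed.

Lemma coenergy_C1 U : C1_2d U w.
Proof.
  exists wx, wy. intros x y _. split; [apply coenergy_slopes|].
  destruct (field_cases x y) as [[-> ->]|Hxy].
  - destruct coenergy_gradient_bound as (C & HC & HB).
    split; apply (continuity_2d_pt_origin _ C); trivial; intros; apply HB.
  - destruct (coenergy_solves x y Hxy) as [Hs _].
    pose proof (slopes_continuous _ _ _ _ _ (coenergy_slopes x y)).
    split; eapply partial_continuous; eauto using continuity_2d_pt_id1, continuity_2d_pt_id2.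
    intros E. apply Hxy. congruence.
Qed.

Lemma coenergy_C2 : 2 <= n -> class_C 2 punctured_plane w.
Proof.
  intros Hn2. split; [|split].
  - intros x y _. eexists _, _. apply slopes_differentiable, coenergy_slopes.
  - replace (fun x y => Derive (fun u => w u y) x) with wx.
    + apply class_C1_of_C1_2d; [apply punctured_plane_open|].
      unfold wx. eapply partial_C1; eauto using C1_2d_fst, C1_2d_snd, coenergy_C1.
      intros x y Hxy. split; trivial. now apply coenergy_solves.
    + extensionality x; extensionality y. symmetry.
      apply (slopes_partials _ _ _ _ _ (coenergy_slopes x y)).
  - replace (fun x y => Derive (fun v => w x v) y) with wy.
    + apply class_C1_of_C1_2d; [apply punctured_plane_open|].
      unfold wy. eapply partial_C1; eauto using C1_2d_fst, C1_2d_snd, coenergy_C1.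
      intros x y Hxy. split; [now apply coenergy_solves|].
      intros E. apply Hxy. congruence.
    + extensionality x; extensionality y. symmetry.
      apply (slopes_partials _ _ _ _ _ (coenergy_slopes x y)).
Qed.

End Coenergy.

(** The C^1 claim fails at n = 1: for b1 = b2 = id one gets
    w h1 h2 = (|h1| + |h2|)^2 / 2, which is not differentiable at (0, 1). *)
Theorem lemma2 (b1 b2 : R -> R) (beta_lo beta_hi : R)
  (Hb1 : smooth b1) (Hb2 : smooth b2)
  (Hlo : 0 < beta_lo)
  (Hbound1 : forall s, beta_lo <= Derive b1 s <= beta_hi)
  (Hbound2 : forall s, beta_lo <= Derive b2 s <= beta_hi)
  (Hodd1 : forall s, b1 (- s) = - b1 s)
  (Hodd2 : forall s, b2 (- s) = - b2 s)
  (hhat1 hhat2 : R -> R)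
  (Hhat1 : inverse_on_halfline (axis_coenergy b1) hhat1)
  (Hhat2 : inverse_on_halfline (axis_coenergy b2) hhat2)
  (n : R) (Hn : 1 <= n)
  (w : R -> R -> R) (Hw : is_coenergy hhat1 hhat2 n w) :
  (1 < n -> class_C 1 plane w) /\
  (2 <= n -> class_C 2 punctured_plane w).
Proof.
  assert (H1 : principal_axis b1 hhat1 beta_lo beta_hi) by now constructor.
  assert (H2 : principal_axis b2 hhat2 beta_lo beta_hi) by now constructor.
  split; intros Hn'.
  - apply class_C1_of_C1_2d.
    + intros x y _. now apply locally_2d_forall.
    + exact (coenergy_C1 _ _ _ _ _ _ _ _ H1 H2 Hn' Hw plane).
  - assert (Hn1 : 1 < n) by lra.
    exact (coenergy_C2 _ _ _ _ _ _ _ _ H1 H2 Hn1 Hw Hn').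
Qed.
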